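(* There is a nonorientable regular embedding of the Hamming graph $H(2,2)$ in the real projective plane. It has type $\{8,2\}_8$, and its automorphism group is a dihedral group of order $16$.
   Context: The Hamming graph $H(d,n)$ has vertex set $\{0,1,\dots,n-1\}^d$, with two vertices adjacent if and only if they differ in exactly one coordinate; so $H(2,2)$ is a cycle of length 4. A map is a 2-cell embedding of a connected graph $K$, with edge set $E$, in a compact connected surface $S$ without boundary. Its flags are its mutually incident vertex-edge-face triples, understood topologically, i.e. the $4|E|$ triangles of the barycentric subdivision of the map (each edge lies in exactly 4 flags). An automorphism of a map is a permutation of its flags that preserves the three relations of differing only in the vertex, only in the edge, or only in the face. The map is regular if its automorphism group acts regularly on flags (equivalently, has order $4|E|$). A regular embedding of $K$ is an embedding of $K$ that gives a regular map; it is nonorientable if $S$ is nonorientable. A regular map has type $\{p,q\}_r$ if $p$ is its covalency (the number of sides of each face), $q$ is the valency of each vertex, and $r$ is its Petrie length (the length of each Petrie polygon, i.e. of each closed zig-zag walk turning alternately first left and first right). Equivalently, for a flag $(v,e,f)$ let $\lambda,\rho,\tau$ be the automorphisms sending it to the flag adjacent to it differing only in $v$, only in $e$, only in $f$ respectively; then $p,q,r$ are the orders of $\lambda\rho$, $\rho\tau$ and $\lambda\rho\tau$. *)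

(* Defs.v *)
From HB Require Import structures.
From mathcomp Require Import all_boot all_order all_algebra all_fingroup all_solvable.
From mathcomp Require Import generic_quotient.
From mathcomp Require Import all_classical all_reals all_analysis.

Set Implicit Arguments.
Unset Strict Implicit.
Unset Printing Implicit Defensive.

Import Order.TTheory GRing.Theory Num.Theory.
Import numFieldNormedType.Exports.

Local Open Scope ring_scope.
Local Open Scope classical_set_scope.
Local Open Scope quotient_scope.

(** * Graphs *)

Definition hamming (d n : nat) : rel {ffun 'I_d -> 'I_n} :=
  fun x y => #|[set i | x i != y i]%SET| == 1%N.

(** * Maps, given by their flags *)

(* [diff_vertex], [diff_edge] and [diff_face] send a flag to the adjacent flag
   (triangle of the barycentric subdivision) that differs from it only in the
   vertex, edge, face respectively.  The surface has no boundary, so these are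
   fixed-point-free involutions.  The four flags containing an edge are
   x, diff_vertex x, diff_face x and diff_vertex (diff_face x), and they are
   distinct.  Multiple edges, loops and valency or covalency 1 are allowed. *)
Record surface_map := SurfaceMap {
  flag :> finType;
  diff_vertex : flag -> flag;
  diff_edge : flag -> flag;
  diff_face : flag -> flag;
  diff_vertexK : involutive diff_vertex;
  diff_edgeK : involutive diff_edge;
  diff_faceK : involutive diff_face;
  diff_vertex_neq : forall x, diff_vertex x != x;
  diff_edge_neq : forall x, diff_edge x != x;
  diff_face_neq : forall x, diff_face x != x;
  diff_vertex_faceC :
    forall x, diff_vertex (diff_face x) = diff_face (diff_vertex x);
  diff_vertex_face_neq : forall x, diff_vertex (diff_face x) != x;
  flag_nonempty : (0 < #|flag|)%N;
  flag_connected : forall x y, connect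
    [rel u v | [|| v == diff_vertex u, v == diff_edge u | v == diff_face u]] x y
}.

Definition orbit2 (T : finType) (f g : T -> T) : rel T :=
  connect [rel u v | (v == f u) || (v == g u)].

(* Two flags have the same vertex (resp. edge) iff one is obtained from the
   other by successive changes of edge and face (resp. vertex and face). *)
Definition same_vertex (M : surface_map) : rel M :=
  orbit2 (@diff_edge M) (@diff_face M).
Definition same_edge (M : surface_map) : rel M :=
  orbit2 (@diff_vertex M) (@diff_face M).

(* The embedded graph of [M] is (isomorphic to) the simple graph [(V, e)]:
   [vtx x] is the vertex of the flag [x]. *)
Definition is_embedding_of (V : finType) (e : rel V) (M : surface_map) : Prop :=
  exists vtx : M -> V,
    [/\ forall v, exists x, vtx x = v,
        forall x y, vtx x = vtx y <-> same_vertex x y,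
        forall x, e (vtx x) (vtx (diff_vertex x)),
        forall u v, e u v ->
          exists x, vtx x = u /\ vtx (diff_vertex x) = v
      & forall x y,
          [set vtx x; vtx (diff_vertex x)]%SET
            = [set vtx y; vtx (diff_vertex y)]%SET
          <-> same_edge x y].

(** * Automorphisms, regularity and type *)

Definition map_aut (M : surface_map) : {set {perm M}} :=
  [set p : {perm M} | [forall x,
    [&& p (diff_vertex x) == diff_vertex (p x),
        p (diff_edge x) == diff_edge (p x)
      & p (diff_face x) == diff_face (p x)]]]%SET.

Lemma map_aut_group_set (M : surface_map) : group_set (map_aut M).
Proof.
apply/group_setP; split.
  by rewrite inE; apply/forallP => x; rewrite !perm1 !eqxx.
move=> p q; rewrite !inE => /forallP hp /forallP hq; apply/forallP => x.
have /and3P[/eqP pv /eqP pe /eqP pf] := hp x.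
have /and3P[/eqP qv /eqP qe /eqP qf] := hq (p x).
by rewrite !permM pv pe pf qv qe qf !eqxx.
Qed.

Canonical map_aut_group (M : surface_map) : {group {perm M}} :=
  Group (map_aut_group_set M).

Definition regular_map (M : surface_map) : Prop :=
  forall x y : M, exists! p : {perm M}, p \in map_aut M /\ p x = y.

(* Number of steps, from the flag [x], of
   - the walk around its face: go to the other end of the edge, then to the next
     edge of the same face;
   - the rotation around its vertex;
   - the zig-zag walk: as around a face, but changing to the face on the other
     side of each edge that is traversed. *)
Definition covalency (M : surface_map) (x : M) : nat :=
  fingraph.order (fun y : M => diff_edge (diff_vertex y)) x.
Definition valency (M : surface_map) (x : M) : nat :=
  fingraph.order (fun y : M => diff_edge (diff_face y)) x.
Definition petrie_length (M : surface_map) (x : M) : nat :=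
  fingraph.order (fun y : M => diff_edge (diff_face (diff_vertex y))) x.

Definition has_type (M : surface_map) (p q r : nat) : Prop :=
  forall x : M, [/\ covalency x = p, valency x = q & petrie_length x = r].

(** * The underlying surface *)

(* The corners of each triangle of the barycentric subdivision are ordered
   (vertex, edge, face).  [o x] says whether this order agrees with a chosen
   orientation of the triangle [x]; adjacent triangles share a side and are
   coherently oriented iff the answers differ. *)
Definition orientable (M : surface_map) : Prop :=
  exists o : M -> bool, forall x,
    [/\ o (diff_vertex x) = ~~ o x,
        o (diff_edge x) = ~~ o x
      & o (diff_face x) = ~~ o x].

Definition homeomorphic (S T : topologicalType) : Prop :=
  exists (f : S -> T) (g : T -> S),
    [/\ continuous f, continuous g, cancel f g & cancel g f].

Section Realization.
Variable R : realType.

(* Barycentric coordinates 0, 1, 2 refer to the vertex, edge, face corners. *)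
Definition triangle : set 'rV[R]_3 :=
  [set x | (forall i, 0 <= x 0 i) /\ \sum_i x 0 i = 1].

Variable M : surface_map.

(* Disjoint union of one triangle per flag *)
Definition triangles : topologicalType := {_ : M & set_type triangle}.

(* The triangles [y] and [diff_vertex y] are glued along the sides opposite to
   their vertex corners, where coordinate 0 vanishes, and so on. *)
Definition glued : rel triangles := fun s t =>
  (tagged s == tagged t) &&
  connect [rel y z | let a := set_val (tagged s) in
    [|| (a 0 0 == 0) && (z == diff_vertex y),
        (a 0 1 == 0) && (z == diff_edge y)
      | (a 0 2 == 0) && (z == diff_face y)]] (tag s) (tag t).

Lemma glued_equiv : equiv_class_of glued.
Proof.
split=> [s|s t|t s u].
- by rewrite /glued eqxx connect0.
- rewrite /glued eq_sym; case: eqVneq => //= ->.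
  apply: sym_connect_sym => y z /=.
  by rewrite ![y == _]eq_sym !(inv_eq (@diff_vertexK M))
    !(inv_eq (@diff_edgeK M)) !(inv_eq (@diff_faceK M)).
- rewrite /glued => /andP[/eqP <- st] /andP[/eqP <- tu]; rewrite eqxx /=.
  exact: connect_trans st tu.
Qed.

Canonical glued_equivRel := EquivRelPack glued_equiv.

Definition surface : topologicalType :=
  quotient_topology {eq_quot glued_equivRel}.

End Realization.

(** * The real projective plane *)

Section ProjectivePlane.
Variable R : realType.

Definition sphere2 : set 'rV[R]_3 := [set x | \sum_i x 0 i ^+ 2 = 1].

Definition antipodal : rel (set_type sphere2) := fun x y =>
  (set_val x == set_val y) || (set_val x == - set_val y).

Lemma antipodal_equiv : equiv_class_of antipodal.
Proof.
split=> [x|x y|y x z]; rewrite /antipodal.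
- by rewrite eqxx.
- by rewrite eq_sym -eqr_oppLR [- _ == _]eq_sym.
- move=> /orP[]/eqP-> /orP[]/eqP->; by rewrite ?opprK eqxx ?orbT.
Qed.

Canonical antipodal_equivRel := EquivRelPack antipodal_equiv.

Definition projective_plane : topologicalType :=
  quotient_topology {eq_quot antipodal_equivRel}.

End ProjectivePlane.

(* Main.v *)
Require Import Defs.
From mathcomp Require Import all_boot all_order all_algebra all_fingroup all_solvable.
From mathcomp Require Import generic_quotient.
From mathcomp Require Import all_classical all_reals all_analysis.
From mathcomp Require Import ring lra.

(** The map is the octagonal hemi-dihedron.  Cut a disc by 16 spokes at angles
    [k * pi / 8] into 16 sectors and identify antipodal points of its boundary
    circle.  Regard the ends of the even spokes as vertices, those of the odd
    spokes as edge midpoints and the centre of the disc as the centre of a face.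
    The result is a 4-cycle in the projective plane with a single face, which
    is an octagon, and its flags are the 16 sectors.  Numbering the sectors by
    Z/16, with sector [i] between spokes [i] and [i + 1], crossing an odd spoke
    changes the vertex, crossing an even spoke changes the edge, and crossing
    the boundary circle is [i |-> i + 8] and changes the face.

    The combinatorial claims are finite.  The graph and the type are read off
    the 16 flags.  The map is nonorientable because eight crossings of spokes,
    an even number, have the same effect as one crossing of the boundary.  The
    reflections [i |-> 1 - i] and [i |-> -1 - i] are automorphisms, and the
    group that they generate is transitive on flags.  As an automorphism of a
    connected map is determined by the image of one flag, that group is the
    whole automorphism group, it is regular of order 16, and it is dihedral
    because it is generated by two involutions ([hemi_dihedron_aut]).

    For the surface, the disc is replaced by the upper half of the unit sphere.
    The triangle of sector [i] is sent linearly onto the convex hull of two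
    spokes, as horizontal unit vectors, and of the north pole ([chart]).  This
    gives a polyhedral cap, which is then projected radially to the sphere.
    Every line through the origin meets the cap ([chart_cover]), and two points
    of the triangles lie on the same line exactly when the gluing identifies
    them ([chart_inj], [chart_flag_glue]); both facts reduce to the planar fan
    of the 16 cones between consecutive spokes, which cover the plane and
    overlap only along common spokes ([cone_cover], [cone_uniq]).  So a
    continuous surjection from a compact space, the disjoint union of the
    triangles, to a Hausdorff space, the projective plane, has as fibres the
    classes of the gluing, and it induces a homeomorphism
    ([quotient_homeomorphic]). *)

Set Implicit Arguments.
Unset Strict Implicit.
Unset Printing Implicit Defensive.

Import Order.TTheory GRing.Theory Num.Theory.
Import numFieldNormedType.Exports.

(** * Automorphisms of maps *)

Section GenericMaps.

(** Commuting involutions generate a quotient of Klein's four-group, so an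
    orbit has at most four points, all of which can be listed. *)
Lemma orbit2E (T : finType) (f g : T -> T) (x y : T) :
  involutive f -> involutive g -> (forall z, f (g z) = g (f z)) ->
  orbit2 f g x y = (y \in [:: x; f x; g x; f (g x)]).
Proof.
move=> fK gK fgC; have gfgK z : g (f (g z)) = f z by rewrite -fgC gK.
apply/idP/idP => [/connectP[p p_path ->]|].
  suff close s z : z \in [:: x; f x; g x; f (g x)] ->
      path [rel u v | (v == f u) || (v == g u)] z s ->
      last z s \in [:: x; f x; g x; f (g x)].
    by apply: close p_path; rewrite mem_head.
  elim: s z => //= w s IHs z z_in /andP[zw]; apply: IHs.
  by move: zw z_in; rewrite !inE => /orP[]/eqP -> /or4P[]/eqP ->;
    rewrite ?fK ?gK ?gfgK -?fgC ?eqxx ?orbT.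
have cf z : orbit2 f g z (f z) by apply: connect1; rewrite /= eqxx.
have cg z : orbit2 f g z (g z) by apply: connect1; rewrite /= eqxx orbT.
rewrite !inE => /or4P[]/eqP -> //; first exact: connect0.
exact: connect_trans (cg x) (cf _).
Qed.

Lemma map_autP (M : surface_map) (p : {perm M}) :
  reflect [/\ {morph p : x / diff_vertex x}, {morph p : x / diff_edge x}
            & {morph p : x / diff_face x}] (p \in map_aut M).
Proof.
rewrite inE; apply: (iffP forallP) => [pM|[pv pe pf] x].
  by split=> x; case/and3P: (pM x) => /eqP pv /eqP pe /eqP pf.
by rewrite pv pe pf !eqxx.
Qed.

(** The image of one flag determines those of its neighbours, and hence, by
    connectedness, of all flags. *)
Lemma map_aut_inj (M : surface_map) (x : M) :
  {in map_aut M &, injective (fun p : {perm M} => p x)}.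
Proof.
move=> p q /map_autP[pv pe pf] /map_autP[qv qe qf] /= pqx.
apply/permP => y; have /connectP[s s_path ->] := flag_connected x y.
elim: s x pqx s_path => //= z s IHs x pqx /andP[xz]; apply: IHs.
by case/or3P: xz => /eqP ->; rewrite ?pv ?qv ?pe ?qe ?pf ?qf pqx.
Qed.

(** A transitive group of automorphisms is the whole automorphism group: for
    each automorphism, some element of the group has the same effect on the
    flag [x], and the two are then equal. *)
Lemma map_aut_regular (M : surface_map) (x : M) (G : {group {perm M}}) :
  G \subset map_aut M -> (forall y, exists2 p, p \in G & p x = y) ->
  [/\ regular_map M, map_aut M = G & #|G| = #|M|].
Proof.
move=> sGA G_trans.
have GE : map_aut M = G.
  apply/eqP; rewrite finset.eqEsubset sGA andbT; apply/fintype.subsetP => p pA.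
  have [q qG qx] := G_trans (p x).
  by rewrite -(map_aut_inj (fintype.subsetP sGA q qG) pA qx).
split=> // [y z|].
  have [p pG <-] := G_trans y; have [q qG <-] := G_trans z.
  exists (p^-1 * q)%g; split=> [|r [rA]].
    by rewrite GE groupM ?groupV // permM permK.
  have pqA : (p^-1 * q)%g \in map_aut M by rewrite GE groupM ?groupV.
  by move=> rx; apply: (map_aut_inj (x := p x)) => //=; rewrite permM permK rx.
have <- : #|[set p x | p : {perm M} in G]%SET| = #|G|.
  by rewrite card_in_imset // => p q pG qG; apply: map_aut_inj; rewrite GE.
by apply: eq_card => y; have [p pG <-] := G_trans y; rewrite imset_f.
Qed.

Lemma eq_set2 (T : finType) (a b c d : T) :
  ([set a; b]%SET = [set c; d]%SET) <->
  (a = c /\ b = d) \/ (a = d /\ b = c).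
Proof.
split=> [/setP E|[[-> ->]|[-> ->]]] //; last by rewrite finset.setUC.
have /eqP := E a; have /eqP := E b; have /eqP := E c; have /eqP := E d.
rewrite !inE !eqxx !orbT /= ![true == _]eq_sym ![_ == true]eqb_id.
do 4![case/orP=> /eqP ?]; subst; auto.
Qed.

End GenericMaps.

(** * The octagonal hemi-dihedron *)

Section HemiDihedron.
Local Open Scope ring_scope.
Implicit Types i j : 'Z_16.

(** Turns a claim about all flags into a closed boolean, to be evaluated. *)
Lemma all_Z16 (P : pred 'Z_16) : all P [seq inZp k | k <- iota 0 16] -> forall i, P i.
Proof.
move=> /allP P16 i; apply: P16; apply/mapP; exists (val i).
  by rewrite mem_iota /= ltn_ord.
by rewrite valZpK.
Qed.

Definition swap_vertex i : 'Z_16 := if odd i then i - 1 else i + 1.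
Definition swap_edge i : 'Z_16 := if odd i then i + 1 else i - 1.
Definition swap_face i : 'Z_16 := i + 8%:R.

Lemma swap_vertexK : involutive swap_vertex.
Proof. by move=> i; apply/eqP; move: i; apply: all_Z16; vm_compute. Qed.
Lemma swap_edgeK : involutive swap_edge.
Proof. by move=> i; apply/eqP; move: i; apply: all_Z16; vm_compute. Qed.
Lemma swap_faceK : involutive swap_face.
Proof. by move=> i; apply/eqP; move: i; apply: all_Z16; vm_compute. Qed.
Lemma swap_vertex_neq i : swap_vertex i != i.
Proof. by move: i; apply: all_Z16; vm_compute. Qed.
Lemma swap_edge_neq i : swap_edge i != i.
Proof. by move: i; apply: all_Z16; vm_compute. Qed.
Lemma swap_face_neq i : swap_face i != i.
Proof. by move: i; apply: all_Z16; vm_compute. Qed.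
Lemma swap_vertex_faceC i : swap_vertex (swap_face i) = swap_face (swap_vertex i).
Proof. by apply/eqP; move: i; apply: all_Z16; vm_compute. Qed.
Lemma swap_edge_faceC i : swap_edge (swap_face i) = swap_face (swap_edge i).
Proof. by apply/eqP; move: i; apply: all_Z16; vm_compute. Qed.
Lemma swap_vertex_face_neq i : swap_vertex (swap_face i) != i.
Proof. by move: i; apply: all_Z16; vm_compute. Qed.
Lemma card_Z16_gt0 : (0 < #|{: 'Z_16}|)%N. Proof. by rewrite card_ord. Qed.

(** The spokes alternate between vertices and edges, so the sector that
    follows [i] is always one of its neighbours. *)
Lemma swap_next i :
  (i + 1 == if odd i then swap_edge i else swap_vertex i).
Proof. by rewrite /swap_edge /swap_vertex; case: (odd i). Qed.

Lemma swap_connected i j : connect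
  [rel u v | [|| v == swap_vertex u, v == swap_edge u | v == swap_face u]] i j.
Proof.
set e := [rel u v | _]; have e_sym : connect_sym e.
  apply: sym_connect_sym => u v /=.
  by rewrite ![u == _]eq_sym !(inv_eq swap_vertexK) !(inv_eq swap_edgeK)
    !(inv_eq swap_faceK).
suff from0 k : connect e 0 k by apply: connect_trans (from0 j); rewrite e_sym.
rewrite -[k]natr_Zp; elim: (val k) => [|n IHn]; first exact: connect0.
apply: (connect_trans IHn); apply: connect1; rewrite mulrS addrC /=.
by move: (swap_next n%:R); case: (odd _) => ->; rewrite ?orbT.
Qed.

Definition hemi_dihedron : surface_map :=
  SurfaceMap swap_vertexK swap_edgeK swap_faceK swap_vertex_neq swap_edge_neq
    swap_face_neq swap_vertex_faceC swap_vertex_face_neq card_Z16_gt0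
    swap_connected.

(** An orientation alternates along the sectors around the centre of the
    disc, so the opposite sectors [0] and [8] agree, although they are
    adjacent across the boundary circle. *)
Lemma hemi_dihedron_nonorientable : ~ orientable hemi_dihedron.
Proof.
case=> o oP; have alternates (i : 'Z_16) : o (i + 1) = ~~ o i.
  by rewrite (eqP (swap_next i)); case: (oP i) => ov oe _; case: (odd i).
have [_ _] := oP (0 : 'Z_16).
have -> : diff_face ((0 : 'Z_16) : hemi_dihedron) = 0 + 1 + 1 + 1 + 1 + 1 + 1 + 1 + 1.
  by apply/eqP; vm_compute.
by rewrite !alternates; case: (o 0).
Qed.

Lemma hemi_dihedron_type : has_type hemi_dihedron 8 2 8.
Proof.
have orderE (f : 'Z_16 -> 'Z_16) n :
    (forall i, [&& fcycle f (traject f i n.+1) & uniq (traject f i n.+1)]) ->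
  forall i, fingraph.order f i = n.+1.
  move=> fP i; have /andP[fc fu] := fP i.
  by rewrite (fingraph.order_cycle fc fu) ?size_traject //= mem_head.
by split; apply: orderE; apply: all_Z16; vm_compute.
Qed.

Definition mirror (c : 'Z_16) : {perm hemi_dihedron} := perm (inv_inj (subKr c)).

Lemma mirrorE c i : mirror c i = c - i. Proof. exact: permE. Qed.

Lemma mirror_aut c : c \in [:: 1; -1] -> mirror c \in map_aut hemi_dihedron.
Proof.
move=> c1; apply/map_autP.
suff commute_c i : [&& c - swap_vertex i == swap_vertex (c - i),
    c - swap_edge i == swap_edge (c - i) & c - swap_face i == swap_face (c - i)].
  by split=> i; rewrite !mirrorE; have /and3P[/eqP ? /eqP ? /eqP ?] := commute_c i.
by move: c1; rewrite !inE => /orP[]/eqP->; move: i; apply: all_Z16; vm_compute.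
Qed.

Lemma order_mirror (c : 'Z_16) : odd c -> #[mirror c]%g = 2%N.
Proof.
move=> c_odd; apply: nt_prime_order => //.
  by apply/permP => i; rewrite expgS expg1 permM !mirrorE perm1 subKr.
apply: contraTneq c_odd => /permP/(_ 0); rewrite mirrorE perm1 subr0 => ->.
by [].
Qed.

Definition mirrors : {group {perm hemi_dihedron}} :=
  <<[set mirror 1%R; mirror (-1)%R]>>%G.

(** The product of the two mirrors is the rotation by two sectors, so its
    powers reach all even sectors; one mirror exchanges even and odd. *)
Lemma mirrors_trans j : exists2 p, p \in mirrors & p 0 = j.
Proof.
pose flip := mirror 1; pose turn := (mirror (-1)%R * flip)%g.
have flipM : flip \in mirrors by rewrite mem_gen ?finset.set21.
have turnM : turn \in mirrors by rewrite groupM ?mem_gen ?finset.set21 ?finset.set22.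
have turnE n i : (turn ^+ n)%g i = i + n.*2%:R.
  elim: n i => [|n IHn] i; first by rewrite expg0 perm1 addr0.
  rewrite expgSr !permM IHn !mirrorE doubleS -(addn2 n.*2) natrD.
  by rewrite opprB opprK addrCA [RHS]addrA.
exists (flip ^+ odd j * turn ^+ (j./2))%g; first by rewrite groupM ?groupX.
rewrite permM turnE -[RHS]natr_Zp -[X in _ = X%:R]odd_double_half natrD.
by congr (_ + _); case: (odd j); rewrite /= ?perm1 // expg1 mirrorE subr0.
Qed.

(** Two involutions generate a dihedral group, whose order is the number of
    flags by regularity. *)
Lemma hemi_dihedron_aut :
  regular_map hemi_dihedron /\
  (map_aut hemi_dihedron \isog [set: dihedral_gtype 16]%G)%g.
Proof.
have sMA : mirrors \subset map_aut hemi_dihedron.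
  rewrite gen_subG; apply/fintype.subsetP => p; rewrite finset.in_set2.
  by case/orP => /eqP ->; apply: mirror_aut; rewrite !inE eqxx ?orbT.
have [regM autE cardG] := map_aut_regular sMA mirrors_trans.
split=> //; rewrite autE.
suff: (mirrors \isog [set: dihedral_gtype #|mirrors|])%g by rewrite cardG card_ord.
apply: involutions_gen_dihedral; rewrite ?order_mirror //.
by apply/eqP => /permP/(_ 0); rewrite !mirrorE.
Qed.

End HemiDihedron.

(** * The embedded graph *)

Section Embedding.
Local Open Scope ring_scope.
Implicit Types i j : 'Z_16.

Definition bit (b : bool) : 'I_2 := if b then ord_max else ord0.

Definition square (c : bool * bool) : {ffun 'I_2 -> 'I_2} :=
  [ffun k => bit (if k == ord0 then c.1 else c.2)].

Lemma bitP (x : 'I_2) : exists b, bit b = x.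
Proof. by case: x => [[|[|//]] x_lt]; [exists false|exists true]; apply: val_inj. Qed.

Lemma bit_inj : injective bit. Proof. by case=> [] []. Qed.

Lemma square_inj : injective square.
Proof.
move=> [a b] [c d] /ffunP E; have := E ord0; have := E ord_max.
by rewrite !ffunE /= => /bit_inj -> /bit_inj ->.
Qed.

Lemma square_surj v : exists c, square c = v.
Proof.
have [[a va] [b vb]] := (bitP (v ord0), bitP (v ord_max)).
exists (a, b); apply/ffunP => k; rewrite ffunE.
have [->|k_neq0] := eqVneq k ord0; first by rewrite va.
have -> : k = ord_max by apply: val_inj; case: k k_neq0 => [[|[|//]]].
by rewrite vb.
Qed.

Lemma hamming_square c d :
  hamming (square c) (square d) = (c.1 != d.1) (+) (c.2 != d.2).
Proof.
rewrite /hamming cardsE -sum1_card big_mkcond !big_ord_recl big_ord0.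
rewrite !unfold_in !ffunE /= !(inj_eq bit_inj).
by case: (c.1 != d.1); case: (c.2 != d.2).
Qed.

(** The end of the even spoke of sector [i] is vertex number [(i + 1) / 2]
    rounded down, modulo 4 as antipodal ends are identified.  The two bits form a Gray code,
    so that consecutive vertices differ in one coordinate. *)
Definition corner i : bool * bool :=
  let k := ((i.+1)./2 %% 4)%N in (0 < k < 3, 1 < k)%N.

Lemma hemi_dihedron_embedding : is_embedding_of (@hamming 2 2) hemi_dihedron.
Proof.
have all2_Z16 (P : rel 'Z_16) :
    all (fun i => all (P i) [seq inZp k | k <- iota 0 16])
      [seq inZp k | k <- iota 0 16] -> forall i j, P i j.
  by move=> /all_Z16 P16 i; exact: all_Z16 (P16 i).
have vertexE i j : (corner i == corner j) ==
    (j \in [:: i; swap_edge i; swap_face i; swap_edge (swap_face i)]).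
  by move: i j; apply: all2_Z16; vm_compute.
have edgeE i j : ((corner i == corner j)
        && (corner (swap_vertex i) == corner (swap_vertex j))
      || (corner i == corner (swap_vertex j))
        && (corner (swap_vertex i) == corner j)) ==
    (j \in [:: i; swap_vertex i; swap_face i; swap_vertex (swap_face i)]).
  by move: i j; apply: all2_Z16; vm_compute.
have adj c d : (c.1 != d.1) (+) (c.2 != d.2) ->
    exists i, corner i = c /\ corner (swap_vertex i) = d.
  pose starts c d := has (fun i => (corner i == c) && (corner (swap_vertex i) == d))
    [seq inZp k | k <- iota 0 16].
  move=> cd; suff /hasP[i _ /andP[/eqP ? /eqP ?]] : starts c d by exists i.
  by case: c d cd => [[] []] [[] []] // _; vm_compute.
exists (fun i : hemi_dihedron => square (corner i)); split.
- move=> v; have [c <-] := square_surj v.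
  have [|i [<- _]] := adj c (~~ c.1, c.2); last by exists i.
  by case: c => [[] []].
- move=> i j; rewrite /same_vertex (orbit2E _ _ swap_edgeK swap_faceK swap_edge_faceC).
  by rewrite -(eqP (vertexE i j)) (rwP eqP) (inj_eq square_inj).
- by move=> i; rewrite hamming_square; move: i; apply: all_Z16; vm_compute.
- move=> u v; have [c <-] := square_surj u; have [d <-] := square_surj v.
  by rewrite hamming_square => /adj[i [<- <-]]; exists i.
move=> i j; rewrite /same_edge (orbit2E _ _ swap_vertexK swap_faceK swap_vertex_faceC).
rewrite -(eqP (edgeE i j)) eq_set2 -!(inj_eq square_inj).
by split=> [[] [-> ->]|/orP[]/andP[/eqP-> /eqP->]]; rewrite ?eqxx ?orbT; auto.
Qed.

End Embedding.

(** * The fan of sixteen planar cones *)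

Section Fan.
Variable R : realType.
Local Open Scope ring_scope.
Implicit Types (x y u w : R) (k i j : nat).

Definition angle k : R := k%:R * (pi / 8%:R).
Definition ray_x k := cos (angle k).
Definition ray_y k := sin (angle k).

Lemma angleD i j : angle (i + j) = angle i + angle j.
Proof. by rewrite /angle natrD mulrDl. Qed.

Lemma angle8 : angle 8 = pi.
Proof. by rewrite /angle mulrC divfK. Qed.

Lemma rayD8 k : ray_x (k + 8) = - ray_x k /\ ray_y (k + 8) = - ray_y k.
Proof. by rewrite /ray_x /ray_y angleD angle8 cosDpi sinDpi. Qed.

Lemma ray_mod16 k : ray_x (k %% 16) = ray_x k /\ ray_y (k %% 16) = ray_y k.
Proof.
have ray16 n : ray_x (k %% 16 + n * 16) = ray_x (k %% 16) /\
               ray_y (k %% 16 + n * 16) = ray_y (k %% 16).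
  elim: n => [|n [IHx IHy]]; first by rewrite addn0.
  rewrite mulSnr (addnA _ _ (8 + 8)) (addnA _ 8 8).
  by rewrite !(proj1 (rayD8 _)) !(proj2 (rayD8 _)) !opprK.
by have [] := ray16 (k %/ 16)%N; rewrite addnC -divn_eq.
Qed.

Lemma ray_y_gt0 k : (0 < k < 8)%N -> 0 < ray_y k.
Proof.
case/andP=> k_gt0 k_lt8; apply: sin_gt0_pi; rewrite -angle8 /angle.
by rewrite ltr_pM2r ?ltr_nat ?k_lt8 ?mulr_gt0 ?invr_gt0 ?ltr0n ?pi_gt0.
Qed.

Lemma ray_y_ge0 k : (k <= 8)%N -> 0 <= ray_y k.
Proof.
rewrite leq_eqVlt => /orP[/eqP->|]; first by rewrite /ray_y angle8 sinpi.
case: k => [|k k_lt8]; last by rewrite ltW ?ray_y_gt0.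
by rewrite /ray_y /angle mul0r sin0.
Qed.

(** The determinant of spoke [k] and the vector [(x, y)]: its sign tells on
    which side of the line of spoke [k] the vector lies. *)
Definition side k x y := ray_x k * y - ray_y k * x.

Lemma side_ray k i : side k (ray_x (k + i)) (ray_y (k + i)) = ray_y i.
Proof.
rewrite /side [X in X - _]mulrC [X in _ - X]mulrC -sinB.
by rewrite angleD addrC addKr.
Qed.

Lemma sideD k u w x y x' y' :
  side k (u * x + w * x') (u * y + w * y') = u * side k x y + w * side k x' y'.
Proof. by rewrite /side; ring. Qed.

Definition cone_x i u u' := u * ray_x i + u' * ray_x i.+1.
Definition cone_y i u u' := u * ray_y i + u' * ray_y i.+1.

Lemma side_cone k i u u' :
  side k (cone_x (k + i) u u') (cone_y (k + i) u u') =
    u * ray_y i + u' * ray_y i.+1.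
Proof. by rewrite sideD -addnS !side_ray. Qed.

Lemma side_coneS i u u' :
  side i.+1 (cone_x i u u') (cone_y i u u') = - (u * ray_y 1).
Proof.
rewrite sideD /side -/(ray_y 1) -(side_ray i 1) /side addn1; ring.
Qed.

Lemma ray_y0 : ray_y 0 = 0. Proof. by rewrite /ray_y /angle mul0r sin0. Qed.

Lemma side_cone0 i u u' : side i (cone_x i u u') (cone_y i u u') = u' * ray_y 1.
Proof. by have := side_cone i 0 u u'; rewrite addn0 ray_y0 mulr0 add0r. Qed.

(** If the cone of spokes [j] and [j + 1] comes after that of [i] and [i + 1],
    by at most half a turn, then the line of spoke [i + 1] separates the two
    cones, and a common point lies on that line. *)
Lemma cone_uniq i j u u' w w' :
  (i <= j <= i + 8)%N -> 0 <= u -> 0 <= u' -> 0 <= w -> 0 <= w' ->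
  cone_x i u u' = cone_x j w w' -> cone_y i u u' = cone_y j w w' ->
  [\/ [/\ j = i, u = w & u' = w'],
      [/\ j = i.+1, u = 0, w' = 0 & u' = w] |
      [/\ u = 0, u' = 0, w = 0 & w' = 0]].
Proof.
move=> /andP[le_ij le_ji8] u0 u'0 w0 w'0 Ex Ey.
have E k : side k (cone_x i u u') (cone_y i u u') =
           side k (cone_x j w w') (cone_y j w w') by rewrite Ex Ey.
have s1 : 0 < ray_y 1 by exact: ray_y_gt0.
move: (le_ij); rewrite leq_eqVlt => /orP[/eqP eq_ij|lt_ij].
  subst j; constructor 1; have := E i.+1; rewrite !side_coneS.
  move=> /oppr_inj/(mulIf (lt0r_neq0 s1)) uw; split=> //.
  by have := E i; rewrite !side_cone0; exact/mulIf/lt0r_neq0.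
have [d jE] : exists d, j = (i.+1 + d)%N by exists (j - i.+1)%N; rewrite subnKC.
have d_le7 : (d <= 7)%N by move: le_ji8; rewrite jE addSnnS leq_add2l.
have Ei := E i; have EiS := E i.+1.
rewrite side_cone0 jE addSnnS side_cone in Ei.
rewrite side_coneS jE side_cone in EiS.
have wd0 : 0 <= w * ray_y d by rewrite mulr_ge0 ?ray_y_ge0 // (leq_trans d_le7).
have w'd0 : 0 <= w' * ray_y d.+1 by rewrite mulr_ge0 ?ray_y_ge0.
have us0 : 0 <= u * ray_y 1 by rewrite mulr_ge0 // ltW.
have cancel_y k x : (0 < k < 8)%N -> x * ray_y k = 0 -> x = 0.
  by move=> /ray_y_gt0/lt0r_neq0 yk /eqP; rewrite mulf_eq0 (negPf yk) orbF => /eqP.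
have u_0 : u = 0 by apply: (cancel_y 1%N) => //; lra.
have wd : w * ray_y d = 0 by lra.
have w'd : w' * ray_y d.+1 = 0 by lra.
have [d0|d_gt0] := posnP d.
  subst d; have w'_0 : w' = 0 by exact: (cancel_y 1%N).
  constructor 2; split; rewrite ?jE ?addn0 //.
  by apply: (mulIf (lt0r_neq0 s1)); rewrite Ei w'_0 mul0r addr0.
have w_0 : w = 0 by apply: (cancel_y d) => //; rewrite d_gt0.
constructor 3; move: d_le7; rewrite leq_eqVlt => /orP[/eqP d7|d_lt7].
  (* A common point of two opposite cones is zero. *)
  have y9 : ray_y 9 = - ray_y 1 := proj2 (rayD8 1).
  move: Ei; rewrite d7 y9 w_0 mul0r add0r mulrN => Ei.
  have u's : 0 <= u' * ray_y 1 by rewrite mulr_ge0 // ltW.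
  have w's : 0 <= w' * ray_y 1 by rewrite mulr_ge0 // ltW.
  by split=> //; apply: (cancel_y 1%N) => //; lra.
have w'_0 : w' = 0 by apply: (cancel_y d.+1).
by split=> //; apply: (cancel_y 1%N) => //; rewrite Ei w_0 w'_0 !mul0r addr0.
Qed.

(** The determinant with spoke [k] changes sign when [k] increases by 8, hence
    it passes from nonnegative to nonpositive between two consecutive spokes.
    The point lies in their cone, with coordinates given by Cramer's rule. *)
Lemma cone_cover x y : exists i u u',
  [/\ (i < 16)%N, 0 <= u, 0 <= u', x = cone_x i u u' & y = cone_y i u u'].
Proof.
have sideD8 k : side (k + 8) x y = - side k x y.
  by have [rx ry] := rayD8 k; rewrite /side rx ry; ring.
have [k0 [k0_le8 side_ge0]] : exists k, (k <= 8)%N /\ 0 <= side k x y.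
  have [?|?] := lerP 0 (side 0 x y); first by exists 0%N.
  by exists 8%N; split=> //; rewrite (sideD8 0%N) oppr_ge0 ltW.
(* The first sign change after [k0]. *)
have [d /andP[d_lt8 ge0] le0] : exists2 d, (d < 8)%N && (0 <= side (k0 + d) x y)
    & side (k0 + d).+1 x y <= 0.
  have : exists d, side (k0 + d.+1) x y <= 0 by exists 7%N; rewrite sideD8 oppr_le0.
  move=> /ex_minnP[d d_le0 d_min]; exists d; last by rewrite -addnS.
  apply/andP; split; first by rewrite ltnS d_min // sideD8 oppr_le0.
  case: d d_le0 d_min => [|d] _ d_min; first by rewrite addn0.
  by rewrite leNgt; apply/negP => /ltW/d_min; rewrite ltnn.
have s1 : 0 < ray_y 1 by exact: ray_y_gt0.
set i := (k0 + d)%N in ge0 le0.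
have s1E : ray_y 1 = ray_x i * ray_y i.+1 - ray_y i * ray_x i.+1.
  by rewrite -(side_ray i 1) addn1.
exists i, (- side i.+1 x y / ray_y 1), (side i x y / ray_y 1).
split.
- by rewrite -[16%N]/(8 + 8)%N -addnS leq_add.
- by rewrite divr_ge0 ?oppr_ge0 // ltW.
- by rewrite divr_ge0 // ltW.
- by rewrite /cone_x /side s1E; field; rewrite -s1E lt0r_neq0.
by rewrite /cone_y /side s1E; field; rewrite -s1E lt0r_neq0.
Qed.

End Fan.

(** * The polyhedral cap *)

Section Charts.
Variable R : realType.
Local Open Scope ring_scope.
Implicit Types (i j : 'Z_16) (a b v w : 'rV[R]_3).

Lemma val_addZ16 i j : val (i + j) = ((val i + val j) %% 16)%N.
Proof. by []. Qed.

Lemma odd_addZ16 i j : odd (i + j)%R = odd (val i) (+) odd (val j).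
Proof. by rewrite val_addZ16 -oddD odd_mod. Qed.

Lemma cone_mod16 k (u u' : R) :
  cone_x (k %% 16) u u' = cone_x k u u' /\ cone_y (k %% 16) u u' = cone_y k u u'.
Proof.
have [x0 y0] := ray_mod16 R k; have [x1 y1] := ray_mod16 R k.+1.
have kS : ((k %% 16).+1 = k.+1 %[mod 16])%N by rewrite -(addn1 k) -modnDml addn1.
have [] := ray_mod16 R (k %% 16).+1; rewrite kS x1 y1 => xS yS.
by rewrite /cone_x /cone_y x0 y0 -xS -yS.
Qed.

Lemma cone_uniq_Z16 i j (u u' w w' : R) :
  0 <= u -> 0 <= u' -> 0 <= w -> 0 <= w' ->
  cone_x i u u' = cone_x j w w' -> cone_y i u u' = cone_y j w w' ->
  [\/ [/\ j = i, u = w & u' = w'],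
      [/\ j = i + 1, u = 0, w' = 0 & u' = w],
      [/\ i = j + 1, w = 0, u' = 0 & w' = u] |
      [/\ u = 0, u' = 0, w = 0 & w' = 0]].
Proof.
wlog le_ij : i j u u' w w' / (i <= j)%N => [IH|].
  move=> u0 u'0 w0 w'0 Ex Ey; have [le_ij|/ltnW le_ji] := leqP i j; first exact: IH.
  have := IH j i w w' u u' le_ji w0 w'0 u0 u'0 (esym Ex) (esym Ey).
  by case=> [[-> -> ->]|[]|[]|[]];
    [constructor 1|constructor 3|constructor 2|constructor 4].
move=> u0 u'0 w0 w'0 Ex Ey.
have [le_ji8|lt_i8j] := leqP j (i + 8).
  have ij8 : (i <= j <= i + 8)%N by rewrite le_ij.
  have [[ji uw uw']|[ji]|[]] := cone_uniq ij8 u0 u'0 w0 w'0 Ex Ey.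
  - by constructor 1; split=> //; apply: val_inj.
  - constructor 2; split=> //; apply: val_inj.
    by rewrite /= addn1 -ji modn_small // ltn_ord.
  - by constructor 4.
have [Px Py] := cone_mod16 (i + 16) u u'.
rewrite modnDr modn_small ?ltn_ord // in Px Py.
have le_ji16 : (j <= i + 16 <= j + 8)%N.
  rewrite (leq_trans (ltnW (ltn_ord j))) ?leq_addl //.
  by rewrite (addnA i 8 8) leq_add2r ltnW.
(* Now [i] is more than half a turn before [j], so [j] is less than half a turn
   before the next occurrence [i + 16] of the spoke [i]. *)
have := cone_uniq le_ji16 w0 w'0 u0 u'0; rewrite -Px -Py.
case/(_ (esym Ex) (esym Ey)) => [[ij _ _]|[ij]|[]].
- by have := ltn_ord j; rewrite -ij ltnNge leq_addl.
- constructor 3; split=> //; apply: val_inj.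
  by rewrite /= addn1 -ij modnDr modn_small ?ltn_ord.
by constructor 4.
Qed.

(** Barycentric coordinates refer to the vertex, edge and face corners, and
    planar cones to the spokes [i] and [i + 1].  The vertex corner of a sector
    lies on its even spoke, and the edge corner on its odd one. *)
Definition left_coord i a := if odd i then a 0 1 else a 0 0.
Definition right_coord i a := if odd i then a 0 0 else a 0 1.

(** The point with barycentric coordinates [a] in the triangle spanned by the
    ends of the spokes [i] and [i + 1] and the north pole. *)
Definition chart i a : 'rV[R]_3 :=
  \row_k [:: cone_x i (left_coord i a) (right_coord i a);
             cone_y i (left_coord i a) (right_coord i a); a 0 2]`_k.

Lemma row3P v w : v = w <-> [/\ v 0 0 = w 0 0, v 0 1 = w 0 1 & v 0 2 = w 0 2].
Proof.
split=> [->//|[v0 v1 v2]]; apply/rowP => -[[|[|[|//]]] k_lt].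
- by rewrite (_ : Ordinal k_lt = 0) //; apply: val_inj.
- by rewrite (_ : Ordinal k_lt = 1) //; apply: val_inj.
by rewrite (_ : Ordinal k_lt = 2) //; apply: val_inj.
Qed.

Lemma sum3 (f : 'I_3 -> R) : \sum_i f i = f 0 + f 1 + f 2.
Proof.
rewrite !big_ord_recl big_ord0 addr0 addrA.
by congr (f _ + f _ + f _); apply: val_inj.
Qed.

Lemma chartE i a : [/\ chart i a 0 0 = cone_x i (left_coord i a) (right_coord i a),
  chart i a 0 1 = cone_y i (left_coord i a) (right_coord i a) & chart i a 0 2 = a 0 2].
Proof. by rewrite !mxE. Qed.

Lemma left_coordS i a : left_coord (i + 1) a = right_coord i a.
Proof. by rewrite /left_coord /right_coord odd_addZ16 addbT; case: odd. Qed.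
Lemma right_coordS i a : right_coord (i + 1) a = left_coord i a.
Proof. by rewrite /left_coord /right_coord odd_addZ16 addbT; case: odd. Qed.
Lemma left_coord8 i a : left_coord (i + 8%:R) a = left_coord i a.
Proof. by rewrite /left_coord odd_addZ16 addbF. Qed.
Lemma right_coord8 i a : right_coord (i + 8%:R) a = right_coord i a.
Proof. by rewrite /right_coord odd_addZ16 addbF. Qed.

Lemma row_coordP i v w : v = w <->
  [/\ left_coord i v = left_coord i w, right_coord i v = right_coord i w & v 0 2 = w 0 2].
Proof.
rewrite row3P /left_coord /right_coord.
by case: (odd i); split=> [[? ? ?]|[? ? ?]]; split.
Qed.

Lemma chart_next i a : left_coord i a = 0 -> chart (i + 1) a = chart i a.
Proof.
move=> l0; apply/row3P.
have [-> -> ->] := chartE (i + 1) a; have [-> -> ->] := chartE i a.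
rewrite left_coordS right_coordS l0 val_addZ16 addn1.
have [-> ->] := cone_mod16 i.+1 (right_coord i a) 0.
by rewrite /cone_x /cone_y !mul0r !add0r !addr0.
Qed.

Lemma chart_opposite i a : a 0 2 = 0 -> chart (i + 8%:R) a = - chart i a.
Proof.
move=> a2; apply/row3P; rewrite ![(- chart i a) _ _]mxE.
have [-> -> ->] := chartE (i + 8%:R) a; have [-> -> ->] := chartE i a.
rewrite left_coord8 right_coord8 a2 oppr0 val_addZ16; split=> //.
  rewrite (proj1 (cone_mod16 _ _ _)) /cone_x -addSn.
  by rewrite !(proj1 (rayD8 R _)) !mulrN opprD.
rewrite (proj2 (cone_mod16 _ _ _)) /cone_y -addSn.
by rewrite !(proj2 (rayD8 R _)) !mulrN opprD.
Qed.

(** The elementary gluings at the point [a], whose reflexive-transitive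
    closure defines [glued]. *)
Definition flag_glue a : rel 'Z_16 := [rel y z | [|| (a 0 0 == 0) && (z == swap_vertex y),
  (a 0 1 == 0) && (z == swap_edge y) | (a 0 2 == 0) && (z == swap_face y)]].

(** The same gluings by position in the disc: across the spoke after [y],
    across the spoke before [y], or across the boundary circle. *)
Lemma flag_glueE a y z : flag_glue a y z = [|| (left_coord y a == 0) && (z == y + 1),
  (left_coord z a == 0) && (y == z + 1) | (a 0 2 == 0) && (z == y + 8%:R)].
Proof.
have -> : (y == z + 1) = (z == y - 1) by rewrite -subr_eq eq_sym.
have -> : (left_coord z a == 0) && (z == y - 1) = (right_coord y a == 0) && (z == y - 1).
  by apply: andb_id2r => /eqP ->; rewrite -[in RHS](subrK 1 y) right_coordS.
rewrite /flag_glue /= /swap_vertex /swap_edge /left_coord /right_coord.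
by case: (odd y) => //; rewrite orbCA.
Qed.

Lemma flag_glue_sym a : connect_sym (flag_glue a).
Proof.
apply: sym_connect_sym => y z; rewrite /flag_glue /=.
by rewrite ![y == _]eq_sym !(inv_eq swap_vertexK) !(inv_eq swap_edgeK)
  !(inv_eq swap_faceK).
Qed.

Lemma chart_flag_glue a i j : connect (flag_glue a) i j ->
  chart j a = chart i a \/ chart j a = - chart i a.
Proof.
move=> /connectP[s s_path ->]; elim: s i s_path => [|z s IHs] i /=; first by left.
rewrite flag_glueE => /andP[iz /IHs IH].
have : chart z a = chart i a \/ chart z a = - chart i a.
  case/or3P: iz => /andP[/eqP l0 /eqP ->].
  - by left; rewrite chart_next.
  - by left; rewrite chart_next.
  - by right; rewrite chart_opposite.
by case: IH => -> [] ->; rewrite ?opprK; auto.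
Qed.

Lemma flag_glue_center a i j : a 0 0 = 0 -> a 0 1 = 0 -> connect (flag_glue a) i j.
Proof.
move=> a0 a1; suff from0 k : connect (flag_glue a) 0 k.
  by apply: connect_trans (from0 j); rewrite flag_glue_sym.
rewrite -[k]natr_Zp; elim: (val k) => [|n IHn]; first exact: connect0.
apply: (connect_trans IHn); apply: connect1.
by rewrite flag_glueE mulrS addrC eqxx /left_coord a0 a1 if_same eqxx.
Qed.

Lemma triangle_ge0 a i : triangle a ->
  [/\ 0 <= left_coord i a, 0 <= right_coord i a & 0 <= a 0 2].
Proof. by case=> a_ge0 _; rewrite /left_coord /right_coord; case: (odd i). Qed.

(** A common ray of two triangles projects to a common point of two planar
    cones.  This leaves equal sectors, neighbouring sectors with the point on
    their common spoke, or the pole, where all sectors are glued.  In each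
    case the barycentric coordinates are proportional, hence equal. *)
Lemma chart_inj_pos (l : R) a b i j : triangle a -> triangle b -> 0 < l ->
  chart i a = l *: chart j b -> a = b /\ connect (flag_glue a) i j.
Proof.
move=> Ta Tb l_gt0 /row3P; rewrite ![(l *: chart j b) _ _]mxE.
have [-> -> ->] := chartE i a; have [-> -> ->] := chartE j b => -[Ex Ey a2].
have [la ra a2_ge0] := triangle_ge0 i Ta; have [lb rb b2_ge0] := triangle_ge0 j Tb.
have {}Ex : cone_x i (left_coord i a) (right_coord i a) =
    cone_x j (l * left_coord j b) (l * right_coord j b).
  by rewrite Ex /cone_x mulrDr !mulrA.
have {}Ey : cone_y i (left_coord i a) (right_coord i a) =
    cone_y j (l * left_coord j b) (l * right_coord j b).
  by rewrite Ey /cone_y mulrDr !mulrA.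
have l_eq0 x : l * x = 0 -> x = 0 by move/eqP; rewrite mulf_eq0 gt_eqF //= => /eqP.
suff [ab ij] : a = l *: b /\ connect (flag_glue a) i j.
  split=> //; rewrite ab; suff -> : l = 1 by rewrite scale1r.
  have [_] := Ta; rewrite ab; under eq_bigr do rewrite mxE.
  by rewrite -mulr_sumr; have [_ ->] := Tb; rewrite mulr1.
have scaleE k : left_coord k a = l * left_coord k b ->
    right_coord k a = l * right_coord k b -> a = l *: b.
  move=> lE rE; apply/(row_coordP k); rewrite lE rE a2 mxE.
  by rewrite /left_coord /right_coord !mxE; case: (odd k).
have := cone_uniq_Z16 la ra (mulr_ge0 (ltW l_gt0) lb) (mulr_ge0 (ltW l_gt0) rb) Ex Ey.
case=> [[-> lE rE]|[jE l0 /l_eq0 r0 rE]|[iE /l_eq0 l0 r0 lE]|[l0 r0 /l_eq0 l'0 /l_eq0 r'0]].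
- by split; [exact: scaleE lE rE|exact: connect0].
- subst j; rewrite left_coordS in rE; rewrite right_coordS in r0; split.
    by apply: (scaleE i); rewrite // l0 r0 mulr0.
  by apply: connect1; rewrite flag_glueE l0 !eqxx.
- subst i; rewrite left_coordS in lE; rewrite right_coordS in r0; split.
    by apply: (scaleE j); rewrite // l0 r0 mulr0.
  by apply: connect1; rewrite flag_glueE r0 !eqxx orbT.
have a00 : a 0 0 = 0 by move: l0 r0; rewrite /left_coord /right_coord; case: (odd i).
have a01 : a 0 1 = 0 by move: l0 r0; rewrite /left_coord /right_coord; case: (odd i).
split; last exact: flag_glue_center.
by apply: (scaleE j); rewrite ?l'0 ?r'0 mulr0 /left_coord /right_coord a00 a01 if_same.
Qed.

(** All heights are nonnegative, so opposite rays are horizontal; there the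
    opposite sector [j + 8] represents the opposite point and is glued to
    [j]. *)
Lemma chart_inj (l : R) a b i j : triangle a -> triangle b -> l != 0 ->
  chart i a = l *: chart j b -> a = b /\ connect (flag_glue a) i j.
Proof.
move=> Ta Tb; rewrite neq_lt => /orP[l_lt0|l_gt0] E; last exact: chart_inj_pos E.
have [_ _ a2_ge0] := triangle_ge0 i Ta; have [_ _ b2_ge0] := triangle_ge0 j Tb.
have a2 : a 0 2 = l * b 0 2.
  by have [_ _ <-] := chartE i a; have [_ _ <-] := chartE j b; rewrite E mxE.
have b2 : b 0 2 = 0.
  by apply/eqP; rewrite eq_le b2_ge0 andbT -(nmulr_rge0 _ l_lt0) -a2.
have {}E : chart i a = - l *: chart (j + 8%:R) b.
  by rewrite chart_opposite // scalerN scaleNr opprK.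
have Nl_gt0 : 0 < - l by rewrite oppr_gt0.
have [<- ij] := chart_inj_pos Ta Tb Nl_gt0 E.
split=> //; apply: (connect_trans ij); apply: connect1.
have j88 : j + 8%:R + 8%:R == j by apply/eqP/swap_faceK.
by rewrite flag_glueE a2 b2 mulr0 eqxx (eq_sym j (_ + 8%:R)) j88 !orbT.
Qed.

Lemma chart_cover v : 0 <= v 0 2 -> v != 0 ->
  exists i a (l : R), [/\ triangle a, 0 < l & chart i a = l *: v].
Proof.
move=> v2_ge0 v_neq0.
have [i [u [u' [i_lt u_ge0 u'_ge0 vx vy]]]] := cone_cover (v 0 0) (v 0 1).
pose s := u + u' + v 0 2.
have s_gt0 : 0 < s.
  have s_ge0 : 0 <= s by rewrite !addr_ge0.
  rewrite lt_neqAle s_ge0 andbT eq_sym; apply: contraNneq v_neq0 => s0.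
  have [u0 u'0 v20] : [/\ u = 0, u' = 0 & v 0 2 = 0] by split; rewrite /s in s0; lra.
  by apply/eqP/row3P; rewrite !mxE vx vy v20 u0 u'0 /cone_x /cone_y !mul0r addr0.
pose k : 'Z_16 := Ordinal i_lt.
pose a : 'rV[R]_3 :=
  \row_m [:: if odd i then u' else u; if odd i then u else u'; v 0 2]`_m.
have aE : [/\ a 0 0 = if odd i then u' else u,
  a 0 1 = (if odd i then u else u') & a 0 2 = v 0 2] by rewrite !mxE.
have [l_a r_a] : left_coord k a = u /\ right_coord k a = u'.
  by rewrite /left_coord /right_coord /=; have [-> -> _] := aE; case: (odd i).
have [a0 a1 a2] := aE.
exists k, (s^-1 *: a), s^-1; rewrite invr_gt0; split=> //.
  split=> [m|].
    rewrite mxE mulr_ge0 ?invr_ge0 ?(ltW s_gt0) // mxE.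
    by case: m => [[|[|[|//]]] ?] //=; case: (odd i).
  under eq_bigr do rewrite mxE.
  rewrite -mulr_sumr sum3 a0 a1 a2; apply: (canLR (mulKf (lt0r_neq0 s_gt0))).
  by rewrite mulr1 /s; case: (odd i); rewrite // (addrC u).
apply/row3P; have [-> -> ->] := chartE k (s^-1 *: a).
rewrite [(s^-1 *: a) 0 2]mxE a2 ![(s^-1 *: v) _ _]mxE.
have leftZ : left_coord k (s^-1 *: a) = s^-1 * u.
  by rewrite -l_a /left_coord; case: ifP => _; rewrite [LHS]mxE.
have rightZ : right_coord k (s^-1 *: a) = s^-1 * u'.
  by rewrite -r_a /right_coord; case: ifP => _; rewrite [LHS]mxE.
rewrite leftZ rightZ vx vy /cone_x /cone_y !mulrDr !mulrA.
by split.
Qed.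

End Charts.

(** * Compactness and quotients *)

Section Topology.
Local Open Scope classical_set_scope.
Local Open Scope quotient_scope.

(** Matrices carry the product topology. *)
Lemma continuous_mx (T U : topologicalType) m n (f : T -> 'M[U]_(m, n)) :
  (forall i j, continuous (fun x => f x i j)) -> continuous f.
Proof.
move=> fc x A [P fxP PA]; rewrite /= !nbhs_simpl /=.
have : \forall y \near x, forall ij : 'I_m * 'I_n, P ij.1 ij.2 (f y ij.1 ij.2).
  by apply: filter_forall => -[i j]; exact: fc (fxP i j).
by apply: filterS => y Py; apply: PA => i j; exact: (Py (i, j)).
Qed.

Lemma continuous_set_type (T U : topologicalType) (A : set U) (f : T -> set_type A) :
  continuous (set_val \o f) -> continuous f.
Proof.
move=> /continuousP fc; apply/continuousP => _ [B oB <-].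
exact: (fc B oB).
Qed.

Lemma set_type_compact (T : topologicalType) (A : set T) :
  compact A -> compact [set: set_type A].
Proof.
move=> cA F FF _.
have FA : (set_val @ F) A by apply: (@filterE _ F) => x; exact: set_valP.
have [p [Ap clp]] := cA _ _ FA.
exists (exist _ p (mem_set Ap)); split=> // B D FB [_ [[C oC <-] Cp] /= CD].
have nC : nbhs p C by apply: open_nbhs_nbhs.
have FB' : (set_val @ F) (set_val @` B) by apply: (@filterS _ F) FB => x Bx; exists x.
have [_ [[x Bx <-] Cx]] := clp _ _ FB' nC.
by exists x; split=> //; exact: CD.
Qed.

Lemma hausdorff_inj (T U : topologicalType) (f : T -> U) :
  continuous f -> injective f -> hausdorff_space U -> hausdorff_space T.
Proof.
move=> fc f_inj hU p q clpq; apply/f_inj/hU => A B fpA fqB.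
have [x [Ax Bx]] := clpq _ _ (fc p A fpA) (fc q B fqB).
by exists (f x).
Qed.

(** The inverse of the induced bijection is continuous because the preimage
    under it of a closed set is the image of a compact set. *)
Lemma quotient_homeomorphic (T Z : topologicalType) (Q : quotType T) (f : T -> Z) :
  compact [set: T] -> hausdorff_space Z -> continuous f ->
  (forall z, exists t, f t = z) ->
  (forall s t, \pi_(quotient_topology Q) s = \pi_(quotient_topology Q) t <-> f s = f t) ->
  homeomorphic (quotient_topology Q) Z.
Proof.
move=> cT hZ fc fsurj fE.
pose g z : quotient_topology Q := \pi_(quotient_topology Q) (projT1 (cid (fsurj z))).
have fg z : f (projT1 (cid (fsurj z))) = z by case: cid.
have f_repr t : f (repr (\pi_(quotient_topology Q) t)) = f t by apply/fE; rewrite reprK.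
exists (f \o repr : quotient_topology Q -> Z), g; split.
- apply: repr_comp_continuous => // a b /eqP ab; apply/eqP/fE; exact: ab.
- apply/continuous_closedP => C cC.
  have -> : g @^-1` C = f @` ((\pi_(quotient_topology Q) : T -> _) @^-1` C).
    apply/seteqP; split=> [z Cz|_ [t Ct <-]]; first by exists (projT1 (cid (fsurj z))).
    rewrite /= /g; suff -> : \pi_(quotient_topology Q) (projT1 (cid (fsurj (f t)))) =
      \pi_(quotient_topology Q) t by [].
    by apply/fE; rewrite fg.
  apply: compact_closed => //; apply: continuous_compact; first exact: continuous_subspaceT.
  apply: subclosed_compact cT _ => //.
  by apply: closed_comp => // t _; exact: pi_continuous.
- move=> q; rewrite /g /= -[RHS]reprK; apply/fE; exact: fg.
- by move=> z; rewrite /= /g f_repr fg.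
Qed.

Variable R : realType.
Local Open Scope ring_scope.

Lemma continuous_add (T : topologicalType) (f g : T -> R) :
  continuous f -> continuous g -> continuous (fun x => f x + g x).
Proof. by move=> fc gc x; apply: cvgD; [exact: fc | exact: gc]. Qed.

Lemma continuous_mul (T : topologicalType) (f g : T -> R) :
  continuous f -> continuous g -> continuous (fun x => f x * g x).
Proof. by move=> fc gc x; apply: cvgM; [exact: fc | exact: gc]. Qed.

Lemma continuous_inv (T : topologicalType) (f : T -> R) :
  (forall x, f x != 0) -> continuous f -> continuous (fun x => (f x)^-1).
Proof. by move=> f_neq0 fc x; apply: cvgV; [exact: f_neq0 | exact: fc]. Qed.

Lemma triangle_compact : compact (@triangle R).
Proof.
have c01 : compact [set v : 'rV[R]_3 | forall i, v ord0 i \in `[0, 1]].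
  apply: (@rV_compact _ _ (fun=> `[(0 : R), 1]%classic)) => i; exact: segment_compact.
apply: subclosed_compact c01 _.
  have -> : @triangle R =
      (\bigcap_(i in setT) ((fun v : 'rV[R]_3 => v 0 i) @^-1` [set x | 0 <= x])) `&`
      ((fun v : 'rV[R]_3 => v 0 0 + v 0 1 + v 0 2) @^-1` [set x | x = 1]).
    apply/seteqP; split=> v [v_ge0 v_sum]; split.
    - by move=> i _; exact: v_ge0.
    - by rewrite /= -sum3.
    - by move=> i; exact: v_ge0.
    - by rewrite sum3.
  apply: closedI.
    apply: closed_bigI => i _; apply: closed_comp (@closed_ge _ 0) => v _.
    exact: coord_continuous.
  apply: closed_comp (@closed_eq _ 1) => v _; move: v.
  by do 2?apply: continuous_add; exact: coord_continuous.
by move=> v [v_ge0 v_sum] i; rewrite /= in_itv /= v_ge0 -v_sum (bigD1 i) //= lerDl sumr_ge0.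
Qed.

(** The Veronese map [x |-> x^T x] separates the lines through the
    origin, so it is a continuous injection of the projective plane into a
    space of matrices, which is Hausdorff. *)
Lemma projective_plane_hausdorff : hausdorff_space (projective_plane R).
Proof.
pose sq (x : set_type (@sphere2 R)) : 'M[R]_3 := (set_val x)^T *m set_val x.
have sqE x k l : sq x k l = set_val x 0 k * set_val x 0 l.
  by rewrite mxE big_ord1 mxE.
have sq_antipodal x y : sq x = sq y <-> antipodal x y.
  split=> [/matrixP sqxy|]; last first.
    by rewrite /antipodal /sq => /orP[]/eqP->; rewrite // (linearN trmx) mulNmx mulmxN opprK.
  have [k xk] : exists k, set_val x 0 k != 0.
    apply/not_existsP => x0; have := set_valP x; rewrite /sphere2 /= big1.
      by move=> /eqP; rewrite eq_sym oner_eq0.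
    by move=> k _; have /negP := x0 k; rewrite negbK => /eqP ->; rewrite expr0n.
  (* The sign is read off a nonzero coordinate [k]. *)
  have same l : set_val x 0 k * set_val x 0 l = set_val y 0 k * set_val y 0 l.
    by rewrite -!sqE.
  have /eqP := same k; rewrite -!expr2 eqf_sqr /antipodal => /orP[]/eqP xyk.
    apply/orP; left; apply/eqP/rowP => l.
    by apply: (mulfI xk); rewrite same xyk.
  apply/orP; right; apply/eqP/rowP => l; apply: (mulfI xk).
  by rewrite mxE same xyk mulrNN.
have sq_cont : continuous sq.
  apply: continuous_mx => k l; rewrite (funext (fun x => sqE x k l)).
  have coord m : continuous (fun x : set_type (@sphere2 R) => set_val x 0 m).
    move=> x; apply: (@continuous_comp _ _ _ set_val (fun v : 'rV[R]_3 => v 0 m)).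
      exact: initial_continuous.
    exact: coord_continuous.
  by apply: continuous_mul; exact: coord.
apply: (@hausdorff_inj _ _ (sq \o repr : projective_plane R -> _)).
- apply: repr_comp_continuous => // x y /eqP xy; apply/eqP/sq_antipodal.
  by move: xy => /eqmodP.
- move=> p q /= /sq_antipodal pq; rewrite -[p]reprK -[q]reprK; exact/eqmodP.
exact: norm_hausdorff.
Qed.

End Topology.

(** * The surface is the projective plane *)

Section HemiDihedronSurface.
Variable R : realType.
Local Open Scope ring_scope.
Local Open Scope classical_set_scope.
Local Open Scope quotient_scope.
Implicit Types (i j : 'Z_16) (v w : 'rV[R]_3) (a b : set_type (@triangle R)).

Definition norm2 v : R := Num.sqrt (\sum_i v 0 i ^+ 2).

Lemma norm2_gt0 v : v != 0 -> 0 < norm2 v.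
Proof.
move=> v_neq0; rewrite sqrtr_gt0 lt_neqAle sumr_ge0 => [|k _]; last exact: sqr_ge0.
rewrite andbT eq_sym; apply: contraNneq v_neq0 => /eqP.
rewrite psumr_eq0 => [/allP v0|k _]; last exact: sqr_ge0.
apply/eqP/rowP => k; rewrite mxE; apply/eqP.
by rewrite -sqrf_eq0; apply: v0; rewrite mem_index_enum.
Qed.

Lemma norm2Z (l : R) v : norm2 (l *: v) = `|l| * norm2 v.
Proof.
rewrite /norm2 -sqrtr_sqr -sqrtrM ?sqr_ge0 // mulr_sumr.
by congr Num.sqrt; apply: eq_bigr => k _; rewrite mxE exprMn.
Qed.

Lemma norm2_sphere v : sphere2 v -> norm2 v = 1.
Proof. by rewrite /norm2 => ->; rewrite sqrtr1. Qed.

Lemma normalize_sphere v : v != 0 -> sphere2 ((norm2 v)^-1 *: v).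
Proof.
move=> v_neq0; rewrite /sphere2 /=.
have <- : norm2 ((norm2 v)^-1 *: v) ^+ 2 = \sum_i ((norm2 v)^-1 *: v) 0 i ^+ 2.
  by rewrite sqr_sqrtr // sumr_ge0 // => k _; exact: sqr_ge0.
rewrite norm2Z ger0_norm ?invr_ge0 ?sqrtr_ge0 // mulVf ?expr1n //.
by rewrite gt_eqF // norm2_gt0.
Qed.

Lemma chart_neq0 i v : triangle v -> chart i v != 0.
Proof.
move=> Tv; have [l_ge0 r_ge0 _] := triangle_ge0 i Tv.
apply/eqP => /row3P; have [-> -> ->] := chartE i v; rewrite !mxE => -[x0 y0 v2].
have cone0 : cone_x i (0 : R) 0 = 0 /\ cone_y i (0 : R) 0 = 0.
  by rewrite /cone_x /cone_y !mul0r addr0.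
have [l0 r0] : left_coord i v = 0 /\ right_coord i v = 0.
  have := cone_uniq_Z16 (i := i) (j := i) l_ge0 r_ge0 (lexx 0) (lexx 0).
  rewrite (proj1 cone0) (proj2 cone0) => /(_ x0 y0).
  by case=> -[].
have [_ /eqP] := Tv; rewrite sum3 v2 addr0.
have -> : v 0 0 + v 0 1 = left_coord i v + right_coord i v.
  by rewrite /left_coord /right_coord; case: (odd i); rewrite // addrC.
by rewrite l0 r0 addr0 eq_sym oner_eq0.
Qed.

Definition to_sphere i a : set_type (@sphere2 R) :=
  exist _ ((norm2 (chart i (set_val a)))^-1 *: chart i (set_val a))
    (mem_set (normalize_sphere (chart_neq0 i (set_valP a)))).

Lemma to_sphere_continuous i : continuous (to_sphere i).
Proof.
have coord k : continuous (fun a => set_val a 0 k).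
  move=> a; apply: (@continuous_comp _ _ _ set_val (fun v : 'rV[R]_3 => v 0 k)).
    exact: initial_continuous.
  exact: coord_continuous.
have cst (x : R) : continuous (fun _ : set_type (@triangle R) => x) by exact: cst_continuous.
have left_c : continuous (fun a => left_coord i (set_val a)).
  by rewrite /left_coord; case: (odd i); exact: coord.
have right_c : continuous (fun a => right_coord i (set_val a)).
  by rewrite /right_coord; case: (odd i); exact: coord.
have chart_c k : continuous (fun a => chart i (set_val a) 0 k).
  case: k => [[|[|[|//]]] k_lt].
  - rewrite (_ : (fun a => _) =
        fun a => cone_x i (left_coord i (set_val a)) (right_coord i (set_val a))).
      by apply: continuous_add; apply: continuous_mul.
    by apply/funext => a; rewrite mxE.
  - rewrite (_ : (fun a => _) =
        fun a => cone_y i (left_coord i (set_val a)) (right_coord i (set_val a))).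
      by apply: continuous_add; apply: continuous_mul.
    by apply/funext => a; rewrite mxE.
  - rewrite (_ : (fun a => _) = fun a => set_val a 0 2); first exact: coord.
    by apply/funext => a; rewrite mxE.
have norm2_c : continuous (fun a => norm2 (chart i (set_val a))).
  move=> a; apply: (@continuous_comp _ _ _
    (fun a => \sum_k chart i (set_val a) 0 k ^+ 2) Num.sqrt);
    last exact: sqrt_continuous.
  rewrite (_ : (fun a => _) = fun a => chart i (set_val a) 0 0 * chart i (set_val a) 0 0 +
    chart i (set_val a) 0 1 * chart i (set_val a) 0 1 +
    chart i (set_val a) 0 2 * chart i (set_val a) 0 2); last first.
    by apply/funext => b; rewrite sum3.
  by move: a; do 2?apply: continuous_add; apply: continuous_mul; exact: chart_c.
apply: continuous_set_type; apply: continuous_mx => m k.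
rewrite (_ : (fun a => _) =
  fun a => (norm2 (chart i (set_val a)))^-1 * chart i (set_val a) 0 k).
  apply: continuous_mul; last exact: chart_c.
  apply: continuous_inv norm2_c => a.
  by rewrite gt_eqF // norm2_gt0 // chart_neq0 //; exact: set_valP.
by apply/funext => a; rewrite /= mxE (ord1 m).
Qed.

(** Radial projection forgets only a positive factor, so antipodality on the
    sphere amounts to proportionality of the points of the cap. *)
Lemma to_sphere_antipodal i j a b : antipodal (to_sphere i a) (to_sphere j b) <->
  a = b /\ connect (flag_glue (set_val a)) i j.
Proof.
set v := chart i (set_val a); set w := chart j (set_val b).
have Ta := set_valP a; have Tb := set_valP b.
have v_gt0 : 0 < norm2 v by rewrite norm2_gt0 ?chart_neq0.
have w_gt0 : 0 < norm2 w by rewrite norm2_gt0 ?chart_neq0.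
rewrite /antipodal /= !set_valE /= -!set_valE -/v -/w; split.
  move=> vw; suff [l l_neq0 E] : exists2 l : R, l != 0 & v = l *: w.
    by have [/val_inj ab ij] := chart_inj Ta Tb l_neq0 E.
  have neq0 : norm2 v * (norm2 w)^-1 != 0.
    by rewrite mulf_neq0 ?invr_neq0 // gt_eqF.
  have vE : v = norm2 v *: ((norm2 v)^-1 *: v).
    by rewrite scalerA mulfV ?scale1r // gt_eqF.
  case/orP: vw => /eqP E; rewrite {}E in vE.
    by exists (norm2 v * (norm2 w)^-1); rewrite // -scalerA.
  by exists (- (norm2 v * (norm2 w)^-1)); rewrite ?oppr_eq0 // scaleNr -scalerA -scalerN.
case=> ab /chart_flag_glue; rewrite {1 3}ab -/v -/w => -[->|->]; first by rewrite eqxx.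
have -> : norm2 (- v) = norm2 v by rewrite -scaleN1r norm2Z normrN1 mul1r.
by rewrite scalerN opprK eqxx orbT.
Qed.

Lemma to_sphere_cover (x : set_type (@sphere2 R)) :
  exists i a, antipodal (to_sphere i a) x.
Proof.
have Sx := set_valP x; set v := set_val x in Sx *.
have [w [w_v Sw w2]] : exists w, [/\ w = v \/ w = - v, sphere2 w & 0 <= w 0 2].
  have [v2|/ltW v2] := lerP 0 (v 0 2); first by exists v; split=> //; left.
  exists (- v); split; [by right| |by rewrite mxE oppr_ge0].
  rewrite /sphere2 /= -Sx; by apply: eq_bigr => k _; rewrite mxE sqrrN.
have w_neq0 : w != 0.
  apply/eqP => w0; have := norm2Z 0 w; rewrite scale0r -{1}w0 norm2_sphere //.
  by move=> /eqP; rewrite normr0 mul0r oner_eq0.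
have [i [a [l [Ta l_gt0 chart_a]]]] := chart_cover w2 w_neq0.
exists i, (exist _ a (mem_set Ta)); rewrite /antipodal.
have -> : set_val (to_sphere i (exist _ a (mem_set Ta))) = w.
  have -> : set_val (to_sphere i (exist _ a (mem_set Ta))) =
    (norm2 (chart i a))^-1 *: chart i a by [].
  rewrite chart_a norm2Z norm2_sphere // mulr1 gtr0_norm // scalerA.
  by rewrite mulVf ?scale1r // gt_eqF.
by case: w_v => ->; rewrite eqxx ?orbT.
Qed.

Definition to_plane (s : triangles R hemi_dihedron) : projective_plane R :=
  \pi_(projective_plane R) (to_sphere (projT1 s) (projT2 s)).

Lemma hemi_dihedron_surface : homeomorphic (surface R hemi_dihedron) (projective_plane R).
Proof.
apply: (quotient_homeomorphic (f := to_plane)).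
- apply: sigT_compact; first exact: finite_finset.
  by move=> _; apply/set_type_compact/triangle_compact.
- exact: projective_plane_hausdorff.
- apply: (@sigT_continuous _ _ _ (fun i a => \pi_(projective_plane R) (to_sphere i a))).
  move=> i a; apply: continuous_comp; first exact: to_sphere_continuous.
  exact: pi_continuous.
- move=> z; have [i [a ia]] := to_sphere_cover (repr z).
  by exists (existT _ i a); rewrite -[z]reprK; apply/eqmodP.
move=> [i a] [j b]; split.
  move=> /eqmodP /andP[/eqP /= ab ij]; apply/eqmodP/to_sphere_antipodal.
  by split.
move=> /eqmodP /to_sphere_antipodal[ab ij]; apply/eqmodP/andP; split=> //=; exact/eqP.
Qed.

End HemiDihedronSurface.

Theorem lemma2p2 (R : realType) :
  exists M : surface_map,
    is_embedding_of (@hamming 2 2) M /\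
    regular_map M /\
    ~ orientable M /\
    homeomorphic (surface R M) (projective_plane R) /\
    has_type M 8 2 8 /\
    (map_aut M \isog [set: dihedral_gtype 16]%G)%g.
Proof.
exists hemi_dihedron; have [regular dihedral] := hemi_dihedron_aut.
split; first exact: hemi_dihedron_embedding.
split; first exact: regular.
split; first exact: hemi_dihedron_nonorientable.
split; first exact: hemi_dihedron_surface.
by split; first exact: hemi_dihedron_type.
Qed.
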